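(* Let $G$ be a group. Suppose there exist a choice of generators $\Sigma^*\to G$, a combing $R\subset\Sigma^*$, and a constant $C$ such that every $R$-triangle $T$ in $G$ satisfies $\delta(T)\le |T|/75+C$. Then $G$ is word hyperbolic.
   Context: A choice of generators for $G$ consists of a finite alphabet $\Sigma$ with formal inverses (a fixed-point-free involution $a\mapsto a^{-1}$ on $\Sigma$, extended by $(wv)^{-1}=v^{-1}w^{-1}$) and a surjective monoid homomorphism $\Sigma^*\to G$, $w\mapsto\overline w$, with $\overline{w^{-1}}=\overline w^{-1}$. A combing is a language $R\subset\Sigma^*$ mapping onto $G$. A path of length $n$ in $G$ is a sequence $g_0,\dots,g_n$ with $g_i=g_{i-1}\overline{a_i}$ for some $a_i\in\Sigma$; its label is $a_1\cdots a_n$. $d(g,h)$ is the length of a shortest path from $g$ to $h$ (the word metric). A triangle $T$ consists of three points of $G$ joined pairwise by paths (its sides); it is an $R$-triangle if the labels of its sides lie in $R$. $T$ is $\delta$-thin if every point on one side is at distance at most $\delta$ from the union of the other two sides; the width $\delta(T)$ is the smallest such $\delta$; the norm $|T|$ is the maximum distance between its vertices. *)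

(* Defs.v *)
From Stdlib Require Import Reals List Arith ClassicalEpsilon.
Import ListNotations.
Set Implicit Arguments.

Record group := Group {
  gcar :> Type;
  gmul : gcar -> gcar -> gcar;
  gone : gcar;
  ginv : gcar -> gcar;
  gmulA : forall x y z, gmul x (gmul y z) = gmul (gmul x y) z;
  gmul1 : forall x, gmul gone x = x;
  gmulV : forall x, gmul (ginv x) x = gone
}.

Record gens (G : group) := Gens {
  alph : Type;
  alph_finite : exists l : list alph, forall a, In a l;
  linv : alph -> alph;
  linv_invol : forall a, linv (linv a) = a;
  linv_nofix : forall a, linv a <> a;
  gen : alph -> G
}.

Section Words.
Variables (G : group) (S : gens G).

Definition eval (w : list (alph S)) : G :=
  fold_right (fun a g => gmul G (gen S a) g) (gone G) w.

Definition winv (w : list (alph S)) : list (alph S) := rev (map (linv S) w).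

Definition valid_gens : Prop :=
  (forall g : G, exists w, eval w = g) /\
  (forall w, eval (winv w) = ginv G (eval w)).

Definition combing (R : list (alph S) -> Prop) : Prop :=
  forall g : G, exists w, R w /\ eval w = g.

Record path := Path { pstart : G; plabel : list (alph S) }.
Definition plength (p : path) : nat := length (plabel p).
Definition vertex (p : path) (i : nat) : G :=
  gmul G (pstart p) (eval (firstn i (plabel p))).
Definition pend (p : path) : G := vertex p (plength p).
Definition on_path (p : path) (x : G) : Prop :=
  exists i, i <= plength p /\ x = vertex p i.

Definition dist_spec (g h : G) (n : nat) : Prop :=
  (exists w, length w = n /\ gmul G g (eval w) = h) /\
  (forall w, gmul G g (eval w) = h -> n <= length w).
Definition dist (g h : G) : nat :=
  epsilon (inhabits 0%nat) (dist_spec g h).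

Definition joins (p : path) (x y : G) : Prop :=
  (pstart p = x /\ pend p = y) \/ (pstart p = y /\ pend p = x).

Record tri := Triangle {
  ta : G; tb : G; tc : G;
  s1 : path; s2 : path; s3 : path
}.
Definition is_triangle (T : tri) : Prop :=
  joins (s1 T) (ta T) (tb T) /\ joins (s2 T) (tb T) (tc T) /\
  joins (s3 T) (tc T) (ta T).

Definition R_triangle (R : list (alph S) -> Prop) (T : tri) : Prop :=
  is_triangle T /\ R (plabel (s1 T)) /\ R (plabel (s2 T)) /\ R (plabel (s3 T)).

Definition close_to (x : G) (d : nat) (p : path) : Prop :=
  exists y, on_path p y /\ dist x y <= d.

Definition thin (T : tri) (d : nat) : Prop :=
  (forall x, on_path (s1 T) x -> close_to x d (s2 T) \/ close_to x d (s3 T)) /\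
  (forall x, on_path (s2 T) x -> close_to x d (s1 T) \/ close_to x d (s3 T)) /\
  (forall x, on_path (s3 T) x -> close_to x d (s1 T) \/ close_to x d (s2 T)).

Definition width (T : tri) : nat :=
  epsilon (inhabits 0%nat) (fun d => thin T d /\ forall d', thin T d' -> d <= d').

Definition tnorm (T : tri) : nat :=
  Nat.max (dist (ta T) (tb T)) (Nat.max (dist (tb T) (tc T)) (dist (tc T) (ta T))).

Definition geodesic (p : path) : Prop := plength p = dist (pstart p) (pend p).

Definition geodesic_triangle (T : tri) : Prop :=
  is_triangle T /\ geodesic (s1 T) /\ geodesic (s2 T) /\ geodesic (s3 T).

End Words.

Definition word_hyperbolic (G : group) : Prop :=
  exists (S : gens G) (delta : nat), valid_gens S /\
    forall T : tri S, geodesic_triangle T -> thin T delta.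

(* Main.v *)
(* Let n = d(a,b), up to additive constants. Bisecting a geodesic [a,b] repeatedly, an
   R-path from a to b stays within (1 + 1/2 + 1/4 + ...) n/75 <= 3n/75 of [a,b]; as it is
   connected, [a,b] in turn stays within 6n/75 of it. Hence geodesic polygons with
   few sides are thin up to a small fraction of their size.

   Thinness of geodesic triangles then improves itself. Suppose all geodesic triangles
   of perimeter at most n are E-thin, and that x on [a,b] is at distance at least E from
   [a,c] and [b,c]. The points a', b' of [a,b] at distance E from x are within E of
   points a'', b'' of the other two sides. If these are on the same side, x lies
   in a quadrilateral of size O(E) with three further sides: one is part of a side of
   the triangle, two are connectors of length at most E. If not, E-thinness of the
   triangle (a'', b'', c) gives points u, v of [a,c], [b,c] at bounded multiples of E
   from a'', b'' and with d(u,v) <= E, and x lies in a hexagon of size O(E). Since the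
   points of a connector are within E/2 of its ends, in both cases x is within less
   than E of [a,c] or [b,c] once E exceeds a constant independent of n.
   This contradiction lets E descend to that constant. *)
Require Import Defs.
From Stdlib Require Import Reals List Arith Lia Lra Classical ClassicalEpsilon.

Set Implicit Arguments.
Unset Strict Implicit.
Open Scope R_scope.

(** * Geodesic segments in an integer-valued metric *)

Section CoarseThinness.
Local Open Scope nat_scope.
Variables (X : Type) (d : X -> X -> nat).
Hypothesis d_refl : forall x, d x x = 0.
Hypothesis d_sym : forall x y, d x y = d y x.
Hypothesis d_tri : forall x y z, d x z <= d x y + d y z.

(** A segment is kept as a point set, its isometric parametrization being hidden, so that it can be
    reversed or cut freely. *)
Definition seg (a b : X) (A : X -> Prop) : Prop :=
  exists g : nat -> X, g 0 = a /\ g (d a b) = b /\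
    (forall i j, i <= j -> j <= d a b -> d (g i) (g j) = j - i) /\
    (forall z, A z <-> exists i, i <= d a b /\ z = g i).

Lemma seg_sym a b A : seg a b A -> seg b a A.
Proof.
intros [g [g0 [g1 [gd gA]]]].
exists (fun i => g (d a b - i)). rewrite (d_sym b a).
split; [now rewrite Nat.sub_0_r|]. split; [now rewrite Nat.sub_diag|]. split.
- intros i j ij jn. rewrite d_sym, gd; lia.
- intros z. rewrite gA. split; intros [i [hi ->]]; exists (d a b - i); split; try lia;
  f_equal; lia.
Qed.

Lemma seg_left a b A : seg a b A -> A a.
Proof. intros [g [g0 [g1 [gd gA]]]]. apply gA. exists 0. split; [lia|easy]. Qed.

Lemma seg_right a b A : seg a b A -> A b.
Proof. intros sA. exact (seg_left (seg_sym sA)). Qed.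

Lemma seg_between a b A x : seg a b A -> A x -> d a x + d x b = d a b.
Proof.
intros [g [g0 [g1 [gd gA]]]] Ax. apply gA in Ax. destruct Ax as [i [hi ->]].
rewrite <- g0 at 1. rewrite <- g1 at 1. rewrite !gd; lia.
Qed.

Lemma seg_dist a b A x y :
  seg a b A -> A x -> A y -> d a x <= d a y -> d x y = d a y - d a x.
Proof.
intros [g [g0 [g1 [gd gA]]]] Ax Ay. apply gA in Ax. apply gA in Ay.
destruct Ax as [i [hi ->]]. destruct Ay as [j [hj ->]].
rewrite <- g0 at 1 2 3 4. rewrite !(gd 0) by lia. intros hij. rewrite gd; lia.
Qed.

Lemma seg_point a b A k : seg a b A -> k <= d a b -> exists x, A x /\ d a x = k.
Proof.
intros [g [g0 [g1 [gd gA]]]] hk. exists (g k). split.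
- apply gA. now exists k.
- rewrite <- g0 at 1. rewrite gd; lia.
Qed.

(** The exact description of [B] serves to recognize a given point of [A] as a point of the
    subsegment. *)
Lemma seg_interval a b A x y :
  seg a b A -> A x -> A y -> d a x <= d a y ->
  exists B, seg x y B /\ forall z, B z <-> A z /\ d x z + d z y = d x y.
Proof.
intros sA Ax Ay hxy. pose proof (seg_dist sA Ax Ay hxy) as dxy.
destruct sA as [g [g0 [g1 [gd gA]]]].
apply gA in Ax. apply gA in Ay.
destruct Ax as [i [hi ->]]. destruct Ay as [j [hj ->]].
rewrite <- g0 in hxy at 1 2. rewrite !(gd 0) in hxy by lia.
rewrite gd in dxy by lia.
exists (fun z => exists k, k <= d (g i) (g j) /\ z = g (i + k)).
rewrite gd by lia. split.
- exists (fun k => g (i + k)). rewrite gd by lia. split; [f_equal; lia|].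
  split; [f_equal; lia|]. split; [|easy].
  intros k l kl hl. rewrite gd; lia.
- intros z. split.
  + intros [k [hk ->]]. split.
    * apply gA. exists (i + k). split; [lia|easy].
    * rewrite !gd; lia.
  + intros [Az hz]. apply gA in Az. destruct Az as [l [hl ->]].
    assert (i <= l /\ l <= j).
    { destruct (Nat.le_ge_cases i l) as [h|h]; destruct (Nat.le_ge_cases l j) as [h'|h'].
      - lia.
      - rewrite (d_sym (g l) (g j)), !gd in hz by lia. lia.
      - rewrite (d_sym (g i) (g l)), !gd in hz by lia. lia.
      - lia. }
    exists (l - i). split; [lia|]. f_equal. lia.
Qed.

Lemma seg_sub a b A x y :
  seg a b A -> A x -> A y -> exists B, seg x y B /\ forall z, B z -> A z.
Proof.
intros sA Ax Ay. destruct (Nat.le_ge_cases (d a x) (d a y)) as [h|h].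
- destruct (seg_interval sA Ax Ay h) as [B [sB hB]].
  exists B. split; [easy|]. intros z. apply hB.
- destruct (seg_interval sA Ay Ax h) as [B [sB hB]].
  exists B. split; [now apply seg_sym|]. intros z. apply hB.
Qed.

(** * Combing paths stay close to geodesics, and conversely *)

Hypothesis d_geodesic : forall x y, exists A, seg x y A.

(** [Q a b z] abstracts: z lies on a combing path between a and b. [Q_thin] is the thinness
    hypothesis with denominators cleared, N bounding the norm. *)
Variables (Q : X -> X -> X -> Prop) (K B1 : nat).
Hypothesis Q_sym : forall a b z, Q a b z -> Q b a z.
Hypothesis Q_connected : forall a b, exists (h : nat -> X) (m : nat),
  h 0 = a /\ h m = b /\ (forall i, i <= m -> Q a b (h i)) /\
  (forall i, i < m -> d (h i) (h (S i)) <= 1).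
Hypothesis Q_thin : forall N a b c z, d a b <= N -> d b c <= N -> d a c <= N ->
  Q a b z -> exists w, (Q b c w \/ Q a c w) /\ 75 * d z w <= N + K.
Hypothesis Q_step : forall a b z, d a b <= 1 -> Q a b z -> d a z <= B1.

(** Cutting the last unit off [a,b] leaves a shorter pair and a pair at distance 1. The crude bound
    only serves to start the bisection. *)
Lemma Q_bounded n : exists B, forall a b z, d a b <= n -> Q a b z -> d a z <= B.
Proof.
induction n as [|n [B IH]].
- exists B1. intros a b z h. apply Q_step. lia.
- exists (B + (B1 + S n) + (S n + K)). intros a b z hab hz.
  destruct (Nat.le_gt_cases (d a b) n) as [h|h].
  { specialize (IH a b z h hz). lia. }
  destruct (d_geodesic a b) as [A sA].
  destruct (@seg_point a b A n sA) as [m [Am dm]]; [lia|].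
  pose proof (seg_between sA Am) as hm.
  destruct (@Q_thin (S n) a b m z) as [w [[hw|hw] hzw]]; try lia; try easy.
  { rewrite d_sym. lia. }
  + assert (d m w <= B1) by (apply (@Q_step m b); [lia|now apply Q_sym]).
    pose proof (d_tri a m w). pose proof (d_tri a w z). rewrite (d_sym w z) in *. lia.
  + assert (d a w <= B) by (apply (IH a m); [lia|easy]).
    pose proof (d_tri a w z). rewrite (d_sym w z) in *. lia.
Qed.

(** Write n = [d a b]. One bisection costs n + K, and 3n = n + 3(n/2) + n/2. Beyond the threshold 2K
    + 4 the last n/2 absorbs K and the rounding of the midpoint, so the additive constant does not
    grow with the number of bisections. *)
Lemma Q_near_seg : exists K1, forall a b A z, seg a b A -> Q a b z ->
  exists y, A y /\ 75 * d z y <= 3 * d a b + K1.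
Proof.
destruct (Q_bounded (2 * K + 4)) as [B HB]. exists (75 * B).
enough (main : forall n a b A z, d a b <= n -> seg a b A -> Q a b z ->
  exists y, A y /\ 75 * d z y <= 3 * d a b + 75 * B).
{ intros a b A z. now apply (main (d a b)). }
induction n as [n IH] using lt_wf_ind. intros a b A z hn sA hz.
destruct (Nat.le_gt_cases (d a b) (2 * K + 4)) as [h|h].
{ exists a. split; [now apply (seg_left sA)|].
  specialize (HB a b z h hz). rewrite d_sym. lia. }
pose proof (Nat.div_mod (d a b) 2 ltac:(lia)) as hdiv.
pose proof (Nat.mod_upper_bound (d a b) 2 ltac:(lia)) as hmod.
destruct (@seg_point a b A (d a b / 2) sA) as [m [Am dm]]; [lia|].
pose proof (seg_between sA Am) as hm.
destruct (@Q_thin (d a b) a b m z) as [w [hw hzw]]; try lia; try easy.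
{ rewrite d_sym. lia. }
enough (hy : exists y, A y /\ 75 * d w y <= 3 * (d a b / 2 + 1) + 75 * B).
{ destruct hy as [y [Ay hy]]. exists y. split; [easy|]. pose proof (d_tri z w y). lia. }
destruct hw as [hw|hw].
- destruct (seg_sub sA Am (seg_right sA)) as [A' [sA' inc]].
  destruct (IH (d m b) ltac:(lia) m b A' w) as [y [Ay hy]]; try easy.
  { now apply Q_sym. }
  exists y. split; [auto|lia].
- destruct (seg_sub sA (seg_left sA) Am) as [A' [sA' inc]].
  destruct (IH (d a m) ltac:(lia) a m A' w) as [y [Ay hy]]; try easy.
  exists y. split; [auto|lia].
Qed.

(** Discrete connectedness of an interval; i = j covers m = 0. *)
Lemma switch_index (P1 P2 : nat -> Prop) m :
  P1 0 -> P2 m -> (forall i, i <= m -> P1 i \/ P2 i) ->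
  exists i j, i <= j <= S i /\ j <= m /\ P1 i /\ P2 j.
Proof.
intros h0 hm hall. induction m as [|m IH].
- exists 0, 0. repeat split; auto; lia.
- destruct (hall m ltac:(lia)) as [h|h].
  + exists m, (S m). repeat split; auto; lia.
  + destruct IH as [i [j [? [? [? ?]]]]]; [easy|intros; apply hall; lia|].
    exists i, j. repeat split; auto; lia.
Qed.

Lemma seg_near_Q : exists K2, forall a b A x, seg a b A -> A x ->
  exists z, Q a b z /\ 75 * d x z <= 6 * d a b + K2.
Proof.
destruct Q_near_seg as [K1 HK1]. exists (2 * K1 + 75).
intros a b A x sA Ax. destruct (Q_connected a b) as [h [m [h0 [hm [hQ hstep]]]]].
pose (near := fun i y => A y /\ 75 * d (h i) y <= 3 * d a b + K1).
(* Along the path, the nearby points of [a,b] pass from before x to after x. At the switch they are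
   at most 2r + 1 apart, where 75r = 3 [d a b] + [K1], so one of them is within r + 1/2 of x. *)
destruct (@switch_index (fun i => exists y, near i y /\ d a y <= d a x)
  (fun i => exists y, near i y /\ d a x <= d a y) m)
  as [i [j [hij [hj [[y [[Ay hy] yx]] [y' [[Ay' hy'] xy']]]]]]].
- exists a. rewrite d_refl. split; [|lia]. split; [exact (seg_left sA)|].
  rewrite h0, d_refl. lia.
- exists b. pose proof (seg_between sA Ax). split; [|lia].
  split; [exact (seg_right sA)|]. rewrite hm, d_refl. lia.
- intros i hi. destruct (HK1 a b A (h i) sA (hQ i hi)) as [y [Ay hy]].
  destruct (Nat.le_ge_cases (d a y) (d a x)); [left|right]; exists y; now split.
- assert (hh : d (h i) (h j) <= 1).
  { assert (e : j = i \/ j = S i) by lia. destruct e as [->| ->].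
    - rewrite d_refl. lia.
    - apply hstep. lia. }
  pose proof (seg_dist sA Ay Ax yx) as e1.
  pose proof (seg_dist sA Ax Ay' xy') as e2.
  pose proof (seg_dist sA Ay Ay' ltac:(lia)) as e3.
  pose proof (d_tri y (h i) y') as t1. pose proof (d_tri (h i) (h j) y') as t2.
  rewrite (d_sym y (h i)) in t1.
  destruct (Nat.le_ge_cases (d y x) (d x y')).
  + exists (h i). split; [apply hQ; lia|].
    pose proof (d_tri x y (h i)) as t3. rewrite (d_sym x y), (d_sym y (h i)) in t3. lia.
  + exists (h j). split; [apply hQ; lia|].
    pose proof (d_tri x y' (h j)) as t3. rewrite (d_sym y' (h j)) in t3. lia.
Qed.

(** * Self-improvement of thin geodesic triangles *)

Definition thin_upto (n D : nat) : Prop :=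
  forall a b c A1 A2 A3, seg a b A1 -> seg b c A2 -> seg a c A3 ->
  d a b + d b c + d a c <= n ->
  forall x, A1 x -> exists y, (A2 y \/ A3 y) /\ d x y <= D.

(** A point of [p,q] is within half its length of an end. That 81/150 is well below 1 will rule out
    points near connectors. *)
Lemma Q_near_ends : exists K1, forall p q z E, d p q <= E -> Q p q z ->
  exists y, (y = p \/ y = q) /\ 150 * d z y <= 81 * E + K1.
Proof.
destruct Q_near_seg as [K1 HK1]. exists (2 * K1). intros p q z E hE hz.
(* 81 E / 150 = E / 2 + 3 E / 75 *)
destruct (d_geodesic p q) as [A sA].
destruct (HK1 p q A z sA hz) as [y [Ay hy]].
pose proof (seg_between sA Ay).
pose proof (d_tri z y p) as t1. pose proof (d_tri z y q) as t2.
rewrite (d_sym y p) in t1.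
destruct (Nat.le_ge_cases (d p y) (d y q)).
- exists p. split; [now left|lia].
- exists q. split; [now right|lia].
Qed.

(** Walking from p to c, each point is within E of [p,q] or of [q,c]; u is taken where the second
    alternative takes over. The extra 1 is the step across the switch. *)
Lemma thin_cut_corner n E p q c A2 A3 :
  thin_upto n E -> seg p c A3 -> seg q c A2 -> d p c + d q c + d p q <= n ->
  exists u v, A3 u /\ A2 v /\ d u v <= E /\
    d p u <= d p q + E + 1 /\ d q u <= d p q + E + 1.
Proof.
intros H s3 s2 hn. destruct (d_geodesic p q) as [A sA].
pose proof s3 as [g [g0 [g1 [gd gA]]]].
destruct (@switch_index (fun i => d p (g i) <= d p q + E /\ d q (g i) <= d p q + E)
  (fun i => exists v, A2 v /\ d (g i) v <= E) (d p c))
  as [i [j [hij [hj [[h1 h2] [v [Av hv]]]]]]].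
- rewrite g0, d_refl, (d_sym q p). lia.
- exists c. rewrite g1, d_refl. split; [exact (seg_right s2)|lia].
- intros i hi.
  destruct (H p c q A3 A2 A s3 (seg_sym s2) sA) with (x := g i) as [y [[Ay|Ay] hy]].
  + rewrite (d_sym c q). lia.
  + apply gA. now exists i.
  + right. now exists y.
  + left. pose proof (seg_between sA Ay).
    pose proof (d_tri p y (g i)). pose proof (d_tri q y (g i)).
    rewrite (d_sym y (g i)), (d_sym q y) in *. lia.
- exists (g j), v. split; [apply gA; now exists j|]. split; [easy|]. split; [easy|].
  assert (d (g i) (g j) <= 1) by (rewrite gd; lia).
  pose proof (d_tri p (g i) (g j)). pose proof (d_tri q (g i) (g j)). lia.
Qed.

(** The quadrilateral p, q, v, u has sides and diagonal pv at most 6E + 1 and is split along pv. The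
    worst case ends at the connector uv: 2(19 + 6 + 6) + 81 = 143, still below 150. *)
Lemma near_corner K0 : exists K3, forall n E p q c A2 A3 x z,
  thin_upto n E -> seg p c A3 -> seg q c A2 -> d p c + d q c + d p q <= n ->
  d p q <= 4 * E -> Q p q z -> 75 * d x z <= 19 * E + K0 ->
  exists y, (A2 y \/ A3 y) /\ 150 * d x y <= 143 * E + K3.
Proof.
destruct Q_near_seg as [K1 HK1]. destruct Q_near_ends as [K2 HK2].
exists (10 + 4 * K + 2 * K0 + 2 * K1 + K2).
intros n E p q c A2 A3 x z H s3 s2 hn hpq hz hxz.
destruct (thin_cut_corner H s3 s2 hn) as [u [v [Au [Av [huv [hpu hqu]]]]]].
pose proof (d_tri p u v) as tp. pose proof (d_tri q u v) as tq.
destruct (@Q_thin (6 * E + 1) p q v z) as [w [[hw|hw] hzw]]; try lia; try easy;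
  pose proof (d_tri x z w) as t1.
- destruct (seg_sub s2 (seg_left s2) Av) as [A [sA inc]].
  destruct (HK1 q v A w sA hw) as [y [Ay hy]]. exists y. split; [auto|].
  pose proof (d_tri x w y). lia.
- destruct (@Q_thin (6 * E + 1) p v u w) as [w' [[hw'|hw'] hww]]; try lia; try easy;
    try (rewrite (d_sym v u); lia); pose proof (d_tri x w w') as t2.
  + destruct (HK2 v u w' E) as [y [hy hwy]]; [rewrite d_sym; lia|easy|].
    exists y. split; [destruct hy as [->| ->]; auto|].
    pose proof (d_tri x w' y). lia.
  + destruct (seg_sub s3 (seg_left s3) Au) as [A [sA inc]].
    destruct (HK1 p u A w' sA hw') as [y [Ay hy]]. exists y. split; [auto|].
    pose proof (d_tri x w' y). lia.
Qed.

Lemma thin_improve : exists D0, forall n D, D0 <= D ->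
  thin_upto n (D + 1) -> thin_upto n D.
Proof.
destruct Q_near_seg as [K1 HK1]. destruct seg_near_Q as [K2 HK2].
destruct Q_near_ends as [K4 HK4]. destruct (near_corner (K2 + 2 * K)) as [K3 HK3].
(* All leading coefficients below are at most 143/150, so beyond this bound every final estimate
   drops below E. *)
exists (1000 * (1 + K + K1 + K2 + K3 + K4)).
intros n D hD H a b c A1 A2 A3 s1 s2 s3 hn x Ax.
apply NNPP. intros hno.
assert (far : forall y, A2 y \/ A3 y -> D + 1 <= d x y).
{ intros y hy. apply Nat.nlt_ge. intros hlt. apply hno. exists y. split; [easy|lia]. }
clear hno. remember (D + 1) as E eqn:eE.
(* The ends a and b lie on the other sides, hence are at distance at least E from x; this makes room
   for a' and b'. *)
pose proof (far a (or_intror (seg_left s3))) as fa.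
pose proof (far b (or_introl (seg_left s2))) as fb.
pose proof (seg_between s1 Ax) as xab. rewrite (d_sym x a) in fa.
destruct (seg_point (k := d a x - E) s1) as [a' [Aa' ha']]; [lia|].
destruct (seg_point (k := d a x + E) s1) as [b' [Ab' hb']]; [lia|].
pose proof (seg_dist s1 Aa' Ax ltac:(lia)) as da'x.
pose proof (seg_dist s1 Ax Ab' ltac:(lia)) as dxb'.
pose proof (seg_dist s1 Aa' Ab' ltac:(lia)) as da'b'.
destruct (H a b c A1 A2 A3 s1 s2 s3 hn a' Aa') as [a'' [Aa'' ha'']].
destruct (H a b c A1 A2 A3 s1 s2 s3 hn b' Ab') as [b'' [Ab'' hb'']].
assert (dba : d b' a'' <= 3 * E).
{ pose proof (d_tri b' a' a''). rewrite (d_sym b' a') in *. lia. }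
assert (dab : d a'' b'' <= 4 * E).
{ pose proof (d_tri a'' b' b''). rewrite (d_sym a'' b') in *. lia. }
destruct (seg_interval s1 Aa' Ab' ltac:(lia)) as [A [sA hA]].
destruct (HK2 a' b' A x sA) as [z0 [hz0 xz0]].
{ apply hA. split; [easy|lia]. }
(* In units of E/75, x is within 12 of Q a' b', hence within 12 + 3 of
   Q b' a'' or Q a' a'', and within 12 + 3 + 4 of Q a'' b'' or Q b' b''. *)
destruct (@Q_thin (3 * E) a' b' a'' z0) as [z1 [[hz1|hz1] z01]]; try lia; try easy;
  pose proof (d_tri x z0 z1) as t1.
(* Both ends of the connector are at distance at least E from x, but 15/75 + 81/150 < 1. The
   connector at b' is excluded likewise, by 19/75 + 81/150 < 1. *)
2: { destruct (HK4 a' a'' z1 E) as [y [hy hzy]]; try easy.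
  pose proof (d_tri x z1 y).
  destruct hy as [->| ->]; [rewrite (d_sym x a') in *|specialize (far a'' Aa'')]; lia. }
destruct (@Q_thin (4 * E) b' a'' b'' z1) as [z2 [[hz2|hz2] z12]]; try lia; try easy;
  pose proof (d_tri x z1 z2) as t2.
2: { destruct (HK4 b' b'' z2 E) as [y [hy hzy]]; try easy.
  pose proof (d_tri x z2 y).
  destruct hy as [->| ->]; [|specialize (far b'' Ab'')]; lia. }
(* On a common side the last move costs 3 times 4 units, and 19 + 12 < 75. *)
assert (same : forall e f Z, seg e f Z -> Z a'' -> Z b'' ->
  (forall y, Z y -> A2 y \/ A3 y) -> False).
{ intros e f Z sZ Za Zb hZ. destruct (seg_sub sZ Za Zb) as [Z' [sZ' inc']].
  destruct (HK1 a'' b'' Z' z2 sZ' hz2) as [y [Zy hy]].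
  pose proof (d_tri x z2 y). specialize (far y (hZ y (inc' y Zy))). lia. }
assert (corner : forall p q z, A3 p -> A2 q -> d p q <= 4 * E -> Q p q z ->
  75 * d x z <= 19 * E + (K2 + 2 * K) -> False).
{ intros p q z Ap Aq hpq hz hxz.
  destruct (seg_sub s3 Ap (seg_right s3)) as [A3' [s3' inc3]].
  destruct (seg_sub s2 Aq (seg_right s2)) as [A2' [s2' inc2]].
  destruct (HK3 n E p q c A2' A3' x z) as [y [hy hxy]]; try easy.
  (* Going from p to q through a and b bounds [d p q], so the triangle p, q, c has perimeter at most
     n. *)
  - pose proof (seg_between s3 Ap). pose proof (seg_between s2 Aq).
    pose proof (d_tri p a q). pose proof (d_tri a b q). rewrite (d_sym p a) in *. lia.
  - assert (hy' : A2 y \/ A3 y) by (destruct hy; auto).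
    specialize (far y hy'). lia. }
destruct Aa'' as [Aa''|Aa'']; destruct Ab'' as [Ab''|Ab''].
- apply (same b c A2); auto.
- apply (corner b'' a'' z2); auto; [rewrite d_sym|]; lia.
- apply (corner a'' b'' z2); auto; lia.
- apply (same a c A3); auto.
Qed.

(** Perimeter n makes a triangle trivially n-thin, since a lies on [a,c]. The descent ends at [D0],
    which does not depend on n. *)
Lemma seg_thin : exists D, forall a b c A1 A2 A3, seg a b A1 -> seg b c A2 -> seg a c A3 ->
  forall x, A1 x -> exists y, (A2 y \/ A3 y) /\ d x y <= D.
Proof.
destruct thin_improve as [D0 H]. exists D0. intros a b c A1 A2 A3 s1 s2 s3.
remember (d a b + d b c + d a c) as n eqn:en.
assert (all : forall k, thin_upto n (D0 + k) -> thin_upto n D0).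
{ induction k as [|k IH]; intros hk.
  - now rewrite Nat.add_0_r in hk.
  - apply IH, H; [lia|]. now replace (D0 + k + 1) with (D0 + S k) by lia. }
enough (Hn : thin_upto n D0) by (apply (Hn a b c A1 A2 A3 s1 s2 s3); lia).
apply (all n). clear - d_sym. intros a b c A1 A2 A3 s1 s2 s3 hn x Ax. exists a.
split; [right; exact (seg_left s3)|]. pose proof (seg_between s1 Ax).
rewrite d_sym. lia.
Qed.

End CoarseThinness.

(** * The word metric and its geodesic paths *)

Section WordMetric.
Local Open Scope nat_scope.
Variables (G : group) (S : gens G).
Hypothesis hS : valid_gens S.

Local Notation "x * y" := (gmul G x y).
Local Notation one := (gone G).
Local Notation inv := (ginv G).

Lemma gmul_invr (x : G) : x * inv x = one.
Proof.
rewrite <- (gmul1 G (x * inv x)), <- (gmulV G (inv x)) at 1.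
rewrite <- gmulA, (gmulA G (inv x)), gmulV, gmul1. apply gmulV.
Qed.

Lemma gmul_oner (x : G) : x * one = x.
Proof. now rewrite <- (gmulV G x), gmulA, gmul_invr, gmul1. Qed.

Lemma gmul_invK (x y : G) : inv x * (x * y) = y.
Proof. now rewrite gmulA, gmulV, gmul1. Qed.

Lemma gmul_Kinv (x y : G) : x * (inv x * y) = y.
Proof. now rewrite gmulA, gmul_invr, gmul1. Qed.

Lemma eval_app (v w : list (alph S)) : eval S (v ++ w) = eval S v * eval S w.
Proof.
induction v as [|a v IH]; simpl.
- now rewrite gmul1.
- now rewrite IH, gmulA.
Qed.

Local Notation dist := (@Defs.dist G S).

(** Surjectivity of [eval] supplies a word and well-ordering a shortest one, so the [epsilon] in
    [dist] is not a default value. *)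
Lemma dist_ok g h : dist_spec S g h (dist g h).
Proof.
apply (epsilon_spec (inhabits 0) (dist_spec S g h)).
destruct (proj1 hS (inv g * h)) as [w hw].
destruct (dec_inh_nat_subset_has_unique_least_element
  (fun n => exists w, length w = n /\ g * eval S w = h)) as [n [[[v [hv1 hv2]] hmin] _]].
- intros n. apply classic.
- exists (length w), w. split; [easy|]. now rewrite hw, gmul_Kinv.
- exists n. split; [now exists v|]. intros u hu. apply hmin. now exists u.
Qed.

Lemma dist_word g h : exists w, length w = dist g h /\ g * eval S w = h.
Proof. exact (proj1 (dist_ok g h)). Qed.

Lemma dist_le g h w : g * eval S w = h -> dist g h <= length w.
Proof. exact (proj2 (dist_ok g h) w). Qed.

Lemma dist_refl g : dist g g = 0.
Proof.
enough (dist g g <= 0) by lia. apply (@dist_le g g nil). apply gmul_oner.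
Qed.

Lemma dist_sym g h : dist g h = dist h g.
Proof.
enough (main : forall g h, dist h g <= dist g h) by (apply Nat.le_antisymm; apply main).
clear g h. intros g h. destruct (dist_word g h) as [w [<- <-]].
replace (length w) with (length (winv S w)) by (unfold winv; now rewrite length_rev, length_map).
apply dist_le. rewrite (proj2 hS w), <- gmulA, gmul_invr. apply gmul_oner.
Qed.

Lemma dist_tri g h k : dist g k <= dist g h + dist h k.
Proof.
destruct (dist_word g h) as [v [<- hv]]. destruct (dist_word h k) as [w [<- hw]].
rewrite <- length_app. apply dist_le. now rewrite eval_app, gmulA, hv.
Qed.

Implicit Type p : path S.

Lemma vertex0 p : vertex p 0 = pstart p.
Proof. apply gmul_oner. Qed.

(** The letters from i to j label the piece between. As [firstn] saturates, indices past the end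
    repeat the last vertex. *)
Lemma vertex_dist p i j : i <= j -> dist (vertex p i) (vertex p j) <= j - i.
Proof.
intros hij. transitivity (length (firstn (j - i) (skipn i (plabel p)))).
- apply dist_le. unfold vertex. rewrite <- gmulA, <- eval_app. do 2 f_equal.
  rewrite firstn_skipn_comm, Nat.add_comm, Nat.sub_add by easy.
  rewrite <- (firstn_skipn i (firstn j (plabel p))) at 2.
  now rewrite firstn_firstn, Nat.min_l.
- apply firstn_le_length.
Qed.

(** The three pieces are no longer than their index ranges, yet add up to at least the whole length,
    so each bound is attained. *)
Lemma vertex_dist_geodesic p i j :
  geodesic p -> i <= j -> j <= plength p -> dist (vertex p i) (vertex p j) = j - i.
Proof.
unfold geodesic, pend. rewrite <- vertex0. intros hp hij hj.
pose proof (vertex_dist p hij).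
pose proof (@vertex_dist p 0 i ltac:(lia)).
pose proof (vertex_dist p hj).
pose proof (dist_tri (vertex p 0) (vertex p i) (vertex p (plength p))).
pose proof (dist_tri (vertex p i) (vertex p j) (vertex p (plength p))).
lia.
Qed.

Lemma geodesic_seg p x y : geodesic p -> joins p x y -> seg dist x y (on_path p).
Proof.
intros hp. assert (main : seg dist (pstart p) (pend p) (on_path p)).
{ unfold seg. rewrite <- hp. exists (vertex p). split; [apply vertex0|]. split; [easy|]. split.
  - intros i j. now apply vertex_dist_geodesic.
  - easy. }
intros [[<- <-]|[<- <-]]; [easy|]. now apply (seg_sym dist_sym).
Qed.

Lemma pend_Path g w : pend (Path S g w) = g * eval S w.
Proof. unfold pend, vertex, plength. simpl. now rewrite firstn_all. Qed.

Lemma dist_geodesic g h : exists A, seg dist g h A.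
Proof.
destruct (dist_word g h) as [w [hw e]]. exists (on_path (Path S g w)).
apply geodesic_seg.
- unfold geodesic. rewrite pend_Path. simpl. now rewrite e.
- left. rewrite pend_Path. now split.
Qed.

Lemma on_path_dist_start p x : on_path p x -> dist x (pstart p) <= plength p.
Proof.
intros [i [hi ->]]. rewrite dist_sym, <- vertex0.
pose proof (@vertex_dist p 0 i ltac:(lia)). lia.
Qed.

Lemma joins_ends p x y : joins p x y -> on_path p x /\ on_path p y.
Proof.
assert (on_path p (pstart p)) by (exists 0; split; [lia|now rewrite vertex0]).
assert (on_path p (pend p)) by (now exists (plength p)).
now intros [[<- <-]|[<- <-]].
Qed.

Lemma joins_start p x y : joins p x y -> pstart p = x \/ pstart p = y.
Proof. intros [[<- _]|[<- _]]; auto. Qed.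

(** Each vertex lies on two sides, so the total length is a crude bound. It makes the [epsilon] in
    [width] meaningful. *)
Lemma thin_exists (T : tri S) : is_triangle T -> exists n, thin T n.
Proof.
intros [h1 [h2 h3]].
exists (plength (s1 T) + plength (s2 T) + plength (s3 T)).
destruct (joins_ends h1), (joins_ends h2), (joins_ends h3).
split; [|split]; intros x hx; apply on_path_dist_start in hx.
- destruct (joins_start h1) as [e|e]; rewrite e in hx;
    [right; exists (ta T)|left; exists (tb T)]; split; auto; lia.
- destruct (joins_start h2) as [e|e]; rewrite e in hx;
    [left; exists (tb T)|right; exists (tc T)]; split; auto; lia.
- destruct (joins_start h3) as [e|e]; rewrite e in hx;
    [right; exists (tc T)|left; exists (ta T)]; split; auto; lia.
Qed.

Lemma thin_width (T : tri S) : is_triangle T -> thin T (width T).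
Proof.
intros hT.
enough (H : exists n, thin T n /\ forall n', thin T n' -> n <= n')
  by exact (proj1 (epsilon_spec (inhabits 0) _ H)).
destruct (dec_inh_nat_subset_has_unique_least_element (thin T)) as [n [hn _]].
- intros n. apply classic.
- now apply thin_exists.
- now exists n.
Qed.

(** * Combing paths in the group as an instance of [Q] *)

Variables (L : list (alph S) -> Prop) (K : nat).
Hypothesis hL : combing S L.
Hypothesis hT : forall T : tri S, R_triangle L T -> 75 * width T <= tnorm T + K.

Let rep (g : G) : list (alph S) := epsilon (inhabits nil) (fun w => L w /\ eval S w = g).

Lemma rep_ok g : L (rep g) /\ eval S (rep g) = g.
Proof.
apply (epsilon_spec (inhabits nil) (fun w => L w /\ eval S w = g)). apply hL.
Qed.

(** The label depends only on the quotient of the ends, so up to translation finitely many sides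
    join points at distance at most 1. *)
Let side a b := Path S a (rep (inv a * b)).

Lemma side_joins a b : joins (side a b) a b.
Proof.
left. split; [easy|]. unfold side. now rewrite pend_Path, (proj2 (rep_ok _)), gmul_Kinv.
Qed.

(** Both directions are included because [L] may not be closed under inversion, while [Q] must be
    symmetric. *)
Let Q a b z := on_path (side a b) z \/ on_path (side b a) z.

Lemma Q_sides a b z : Q a b z ->
  exists p, joins p a b /\ L (plabel p) /\ on_path p z /\ forall y, on_path p y -> Q a b y.
Proof.
intros [hz|hz]; [exists (side a b)|exists (side b a)];
  (split; [|split; [apply rep_ok|split; [easy|unfold Q; auto]]]).
- apply side_joins.
- destruct (side_joins b a); [right|left]; easy.
Qed.

Lemma Q_triangle N a b c z : dist a b <= N -> dist b c <= N -> dist a c <= N ->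
  Q a b z -> exists w, (Q b c w \/ Q a c w) /\ 75 * dist z w <= N + K.
Proof.
intros hab hbc hac hz. destruct (Q_sides hz) as [p [jp [Lp [pz _]]]].
pose (T := Triangle a b c p (side b c) (side c a)).
assert (tT : is_triangle T) by (split; [easy|split; apply side_joins]).
assert (wT : 75 * width T <= N + K).
{ transitivity (tnorm T + K).
  - apply hT. split; [easy|]. split; [easy|]. split; apply rep_ok.
  - unfold tnorm. simpl. rewrite (dist_sym c a). lia. }
destruct (proj1 (thin_width tT) z pz) as [[w [hw hzw]]|[w [hw hzw]]];
  exists w; unfold Q; (split; [tauto|lia]).
Qed.

Lemma Q_path a b : exists (h : nat -> G) (m : nat),
  h 0 = a /\ h m = b /\ (forall i, i <= m -> Q a b (h i)) /\
  (forall i, i < m -> dist (h i) (h (Datatypes.S i)) <= 1).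
Proof.
exists (vertex (side a b)), (plength (side a b)). split; [now rewrite vertex0|]. split.
{ change (pend (side a b) = b). unfold side.
  now rewrite pend_Path, (proj2 (rep_ok _)), gmul_Kinv. }
split.
- intros i hi. left. now exists i.
- intros i _. pose proof (@vertex_dist (side a b) i (Datatypes.S i) ltac:(lia)). lia.
Qed.

Lemma Q_unit : exists B, forall a b z, dist a b <= 1 -> Q a b z -> dist a z <= B.
Proof.
destruct (alph_finite S) as [l hl].
assert (fin : forall l' : list (alph S), exists B, length (rep one) <= B /\
    forall s, In s l' -> length (rep (gen S s)) <= B).
{ induction l' as [|s l' [B [h1 hB]]].
  - now exists (length (rep one)).
  - exists (B + length (rep (gen S s))). split; [lia|]. intros t [->|ht]; [lia|].
    specialize (hB t ht). lia. }
destruct (fin l) as [B [h1 hB]].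
assert (len : forall a b, dist a b <= 1 -> plength (side a b) <= B).
{ intros a b hab. destruct (dist_word a b) as [w [hw <-]]. unfold plength, side. simpl.
  (* The quotient of the ends is the identity or a single generator. *)
  rewrite gmul_invK. destruct w as [|s [|t w]]; simpl in *; [easy| |lia].
  rewrite gmul_oner. apply hB, hl. }
exists (B + 1). intros a b z hab [hz|hz]; apply on_path_dist_start in hz; simpl in hz.
- rewrite dist_sym. specialize (len a b hab). lia.
- specialize (len b a). rewrite (dist_sym b a) in len. specialize (len hab).
  pose proof (dist_tri a b z). rewrite (dist_sym b z) in *. lia.
Qed.

Lemma geodesic_triangles_thin : exists D, forall T : tri S, geodesic_triangle T -> thin T D.
Proof.
destruct Q_unit as [B HB].
destruct (@seg_thin G dist dist_refl dist_sym dist_tri dist_geodesic Q K B) as [D HD].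
- unfold Q. tauto.
- exact Q_path.
- exact Q_triangle.
- exact HB.
- exists D. intros T [[j1 [j2 j3]] [g1 [g2 g3]]].
  pose proof (geodesic_seg g1 j1) as e1. pose proof (geodesic_seg g2 j2) as e2.
  pose proof (geodesic_seg g3 j3) as e3.
  pose proof (seg_sym dist_sym e1) as f1. pose proof (seg_sym dist_sym e2) as f2.
  pose proof (seg_sym dist_sym e3) as f3.
  assert (close : forall x (p q : path S), (exists y, (on_path p y \/ on_path q y) /\ dist x y <= D) ->
    close_to x D p \/ close_to x D q).
  { intros x p q [y [[hy|hy] hxy]]; [left|right]; now exists y. }
  split; [|split]; intros x hx.
  + apply close. exact (HD _ _ _ _ _ _ e1 e2 f3 x hx).
  + apply or_comm, close. exact (HD _ _ _ _ _ _ e2 e3 f1 x hx).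
  + apply close. exact (HD _ _ _ _ _ _ e3 e1 f2 x hx).
Qed.

End WordMetric.

Theorem theorem3p1 (G : group) :
  (exists (S : gens G) (L : list (alph S) -> Prop) (C : R),
      @valid_gens G S /\ @combing G S L /\
      forall T : @tri G S, @R_triangle G S L T ->
        INR (@width G S T) <= INR (@tnorm G S T) / 75 + C) ->
  word_hyperbolic G.
Proof.
intros [S [L [C [hS [hL hT]]]]].
(* A natural number above 75C turns the real bound into one between naturals. *)
destruct (INR_unbounded (75 * C)) as [K hK].
destruct (@geodesic_triangles_thin G S hS L K hL) as [D HD].
- intros T RT. specialize (hT T RT). apply INR_le.
  rewrite mult_INR, plus_INR, (INR_IZR_INZ 75). simpl (IZR _). lra.
- exists S, D. now split.
Qed.
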